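(* Let $\mathfrak{X}$ be a saturated fusion action system of a finite $p$-group $S$ on a finite set $X$, and suppose $S$ acts faithfully on $X$. Let $G=\mathfrak{X}(1)\le\Sigma_X$ be the group of permutations of $X$ that appear in some morphism of $\mathfrak{X}$, and identify $S$ with its image in $G$ under the injection $s\mapsto\ell_s$. Then $\mathcal{F}^{\mathfrak{X}}=\mathcal{F}_G$, where $\mathcal{F}_G=\mathcal{F}_S(G)$ is the fusion system on $S$ relative to $G$.
   Context: Let $p$ be a prime, $S$ a finite $p$-group, and $X$ a finite set with a left $S$-action; $\Sigma_X$ is the symmetric group on $X$, $\ell_s\in\Sigma_X$ is the permutation $x\mapsto s\cdot x$, and $c_s$ is conjugation $h\mapsto shs^{-1}$. $\mathrm{Inj}(P,Q)$ is the set of injective homomorphisms $P\to Q$. A pair $(\varphi,\sigma)\in\mathrm{Inj}(P,Q)\times\Sigma_X$ ($P,Q\le S$) is intertwined if $\sigma\ell_p\sigma^{-1}=\ell_{\varphi(p)}$ for all $p\in P$. Let $\mathfrak{U}$ be the category whose objects are all subgroups of $S$, whose morphisms $P\to Q$ are the intertwined pairs, composed componentwise. Let $\mathfrak{X}_S\subseteq\mathfrak{U}$ have the same objects and morphisms $P\to Q$ the pairs $(c_s|_P,\ell_s)$ with $s\in S$, $sPs^{-1}\le Q$. A fusion action system of $S$ on $X$ is a category $\mathfrak{X}$ with $\mathfrak{X}_S\subseteq\mathfrak{X}\subseteq\mathfrak{U}$ such that every morphism of $\mathfrak{X}$ factors as an isomorphism of $\mathfrak{X}$ followed by an inclusion $(\mathrm{incl},\mathrm{id}_X)$.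 Write $\mathfrak{X}(P)=\mathfrak{X}(P,P)$ and $\mathfrak{X}(P,Q)_{\mathrm{iso}}$ for the isomorphisms; $\mathfrak{X}(1)$ (automorphisms of the trivial subgroup) is identified with a subgroup of $\Sigma_X$. The underlying fusion system $\mathcal{F}^{\mathfrak{X}}$ has the subgroups of $S$ as objects and $\mathcal{F}^{\mathfrak{X}}(P,Q)=\{\varphi : \exists\sigma,\ (\varphi,\sigma)\in\mathfrak{X}(P,Q)\}$; two subgroups are conjugate if they are isomorphic in $\mathcal{F}^{\mathfrak{X}}$. Let $C=\{s\in S:\ell_s=\mathrm{id}_X\}$, $N_S(P;X)=N_S(P)\cap C$, $Z_S(P;X)=Z_S(P)\cap C$. A subgroup $P\le S$ is fully normalized (resp. fully centralized, fully $X$-normalized, fully $X$-centralized) if $|N_S(P)|\ge|N_S(Q)|$ (resp. the same inequality for $Z_S(-)$, $N_S(-;X)$, $Z_S(-;X)$) for all $Q$ conjugate to $P$. Put $\mathrm{Aut}_S(P)=\{c_s|_P:s\in N_S(P)\}$, $\mathrm{Aut}_S(P;X)=\{(c_s|_P,\ell_s):s\in N_S(P)\}$, $\Sigma_{\mathfrak{X}}(P)=\{\sigma:\exists\varphi,(\varphi,\sigma)\in\mathfrak{X}(P)\}$, $\Sigma^S_{\mathfrak{X}}(P)=\{\ell_s:s\in N_S(P)\}$, $\mathcal{F}^{\mathfrak{X}}(P)_0=\{\varphi:(\varphi,\mathrm{id}_X)\in\mathfrak{X}(P)\}$, $\mathcal{F}_S(P)_0=\{c_s|_P:s\in N_S(P;X)\}$,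 $\Sigma_{\mathfrak{X}}(P)_0=\{\sigma:(\mathrm{id}_P,\sigma)\in\mathfrak{X}(P)\}$, $\Sigma^S_{\mathfrak{X}}(P)_0=\{\ell_s:s\in Z_S(P)\}$. The extender of $(\varphi,\sigma)\in\mathfrak{X}(P,Q)_{\mathrm{iso}}$ is $N_{(\varphi,\sigma)}=\{n\in N_S(P):(\varphi c_n\varphi^{-1},\sigma\ell_n\sigma^{-1})\in\mathrm{Aut}_S(Q;X)\}$. $\mathfrak{X}$ is saturated if: (1) for every $P\le S$, fully normalized implies fully $X$-normalized and fully centralized, and each of fully $X$-normalized and fully centralized implies fully $X$-centralized; (2) if $P$ is fully normalized then $\mathrm{Aut}_S(P)\in\mathrm{Syl}_p(\mathcal{F}^{\mathfrak{X}}(P))$, $\mathrm{Aut}_S(P;X)\in\mathrm{Syl}_p(\mathfrak{X}(P))$ and $\Sigma^S_{\mathfrak{X}}(P)\in\mathrm{Syl}_p(\Sigma_{\mathfrak{X}}(P))$; (3) if $P$ is fully $X$-normalized then $\mathcal{F}_S(P)_0\in\mathrm{Syl}_p(\mathcal{F}^{\mathfrak{X}}(P)_0)$; (4) if $P$ is fully centralized then $\Sigma^S_{\mathfrak{X}}(P)_0\in\mathrm{Syl}_p(\Sigma_{\mathfrak{X}}(P)_0)$; (5) if $Q$ is fully $X$-centralized and $(\varphi,\sigma)\in\mathfrak{X}(P,Q)_{\mathrm{iso}}$, there is $(\widetilde\varphi,\sigma)\in\mathfrak{X}(N_{(\varphi,\sigma)},S)$ with $\widetilde\varphi|_P=\varphi$.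 For a finite group $G$ with $S\le G$, $\mathcal{F}_S(G)$ is the category whose objects are the subgroups of $S$ and whose morphisms $P\to Q$ are the maps $c_g|_P$ with $g\in G$, $gPg^{-1}\le Q$. *)

(* Defs.v *)
From HB Require Import structures.
From mathcomp Require Import all_boot all_fingroup all_solvable.

Set Implicit Arguments.
Unset Strict Implicit.
Unset Printing Implicit Defensive.

Local Open Scope group_scope.

(* The product of {perm T} is composition from left to right.  All groups of
   permutations below are taken in [sym T], which has the same elements as
   {perm T} but whose product is the usual composition of functions: this makes
   a left action a homomorphism, and s * h * s^-1 the usual conjugation. *)
Definition sym (T : finType) : Type := {perm T}.
HB.instance Definition _ (T : finType) := Finite.copy (sym T) {perm T}.

Section SymGroup.
Variable T : finType.
Implicit Types s t u : sym T.

Definition sym_mul s t : sym T := (t : {perm T}) * (s : {perm T}).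
Definition sym_one : sym T := (1 : {perm T}).
Definition sym_inv s : sym T := (s : {perm T})^-1.

Fact sym_mulA : associative sym_mul.
Proof. by move=> s t u; rewrite /sym_mul mulgA. Qed.
Fact sym_mul1 : left_id sym_one sym_mul.
Proof. by move=> s; rewrite /sym_mul mulg1. Qed.
Fact sym_mulV : left_inverse sym_one sym_inv sym_mul.
Proof. by move=> s; rewrite /sym_mul mulgV. Qed.

HB.instance Definition _ :=
  Finite_isGroup.Build (sym T) sym_mulA sym_mul1 sym_mulV.

Lemma symM s t x : (s * t : sym T) x = s (t x).
Proof. exact: permM. Qed.
Lemma sym1 x : (1 : sym T) x = x.
Proof. exact: perm1. Qed.
Lemma symP s t : s =1 t <-> s = t.
Proof. exact: permP. Qed.

End SymGroup.

Record left_action (S : finGroupType) (X : finType) := LeftAction {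
  lact :> S -> X -> X;
  lact1 : forall x, lact 1 x = x;
  lactM : forall s t x, lact (s * t) x = lact s (lact t x)
}.

Definition faithful_action (S : finGroupType) (X : finType)
    (a : left_action S X) : Prop :=
  forall s, (forall x, a s x = x) -> s = 1.

Section Ell.
Variables (S : finGroupType) (X : finType) (a : left_action S X).

Fact lact_inj s : injective (a s).
Proof.
by apply: (can_inj (g := a s^-1)) => x; rewrite -lactM mulVg lact1.
Qed.

Definition ell (s : S) : sym X := perm (@lact_inj s).

Lemma ellE s x : ell s x = a s x.
Proof. exact: permE. Qed.

Lemma ellM : {in [set: S] &, {morph ell : s t / s * t}}.
Proof. by move=> s t _ _; apply/symP=> x; rewrite symM !ellE lactM. Qed.

Canonical ell_morphism := Morphism ellM.

End Ell.

Section Hom.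
Variable S : finGroupType.
Implicit Types P Q R : {group S}.

(* Maps between the subgroups themselves (as types), so that equality in
   [hom P Q] is equality of functions on P; being an injective homomorphism is
   the predicate [Inj] below. *)
Definition hom P Q := {ffun [subg P] -> [subg Q]}.

Definition Inj P Q : {set hom P Q} :=
  [set f : hom P Q | injectiveb f & [forall x, forall y, f (x * y) == f x * f y]].

Definition hcomp P Q R (g : hom Q R) (f : hom P Q) : hom P R :=
  [ffun x => g (f x)].

Definition hid P : hom P P := [ffun x => x].

(* The inclusion and the restriction of c_s; [subg] is total, and these are used
   only when P \subset Q, respectively s P s^-1 \subset Q. *)
Definition incl P Q : hom P Q := [ffun x => subg Q (sgval x)].

Definition chom P Q (s : S) : hom P Q :=
  [ffun x => subg Q (s * sgval x * s^-1)].

(* The inverse of a bijective f (with an arbitrary value outside the image). *)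
Definition hinv P Q (f : hom P Q) : hom Q P :=
  [ffun y => odflt 1 [pick x | f x == y]].

(* The permutations of P belonging to a set of endomorphisms of P, and below the
   same for pairs, so that Sylow subgroups can be taken in the groups sym P and
   sym P * sym X. *)
Definition perms P (A : {set hom P P}) : {set sym (subg_of P)} :=
  [set u : sym (subg_of P) | [ffun x => u x] \in A].

Definition isomorphic_in (F : forall P Q, {set hom P Q}) P Q : Prop :=
  exists f : hom P Q, exists g : hom Q P,
    [/\ f \in F P Q, g \in F Q P, hcomp g f = hid P & hcomp f g = hid Q].

End Hom.

Section Pairs.
Variables (S : finGroupType) (X : finType) (a : left_action S X).
Implicit Types P Q R : {group S}.
Local Notation "'\l' s" := (ell a s) (at level 8, s at level 7).

Definition mor P Q := (hom P Q * sym X)%type.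

Definition mcomp P Q R (g : mor Q R) (f : mor P Q) : mor P R :=
  (hcomp g.1 f.1, g.2 * f.2).

Definition mid P : mor P P := (hid P, 1).

Definition mincl P Q : mor P Q := (incl P Q, 1).

Definition pairs P (A : {set mor P P}) : {set sym (subg_of P) * sym X} :=
  [set u : sym (subg_of P) * sym X | ([ffun x => u.1 x], u.2) \in A].

Definition intertwined P Q : {set mor P Q} :=
  [set f : mor P Q | f.1 \in Inj P Q &
    [forall x, f.2 * \l (sgval x) * f.2^-1 == \l (sgval (f.1 x))]].

(* The morphisms coming from S; P :^ s^-1 is s P s^-1. *)
Definition trans_mor P Q : {set mor P Q} :=
  [set (chom P Q s, \l s) | s : S & P :^ s^-1 \subset Q].

Definition iso (XX : forall P Q, {set mor P Q}) P Q : {set mor P Q} :=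
  [set f in XX P Q | [exists g in XX Q P,
     (mcomp g f == mid P) && (mcomp f g == mid Q)]].

Record fusion_action_system := FusionActionSystem {
  fas_mor :> forall P Q, {set mor P Q};
  fas_id : forall P, mid P \in fas_mor P P;
  fas_comp : forall P Q R (g : mor Q R) (f : mor P Q),
    g \in fas_mor Q R -> f \in fas_mor P Q -> mcomp g f \in fas_mor P R;
  fas_trans : forall P Q, trans_mor P Q \subset fas_mor P Q;
  fas_intertwined : forall P Q, fas_mor P Q \subset intertwined P Q;
  fas_factor : forall P Q (f : mor P Q), f \in fas_mor P Q ->
    exists R, exists2 g : mor P R, g \in iso fas_mor P R &
      R \subset Q /\ f = mcomp (mincl R Q) g
}.

Definition act_ker : {set S} := [set s | \l s == 1].

Definition NX P : {set S} := 'N(P) :&: act_ker.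
Definition ZX P : {set S} := 'C(P) :&: act_ker.

Definition Aut_S P : {set hom P P} := [set chom P P s | s in 'N(P)].
Definition Aut_SX P : {set mor P P} := [set (chom P P s, \l s) | s in 'N(P)].
Definition Sigma_S P : {set sym X} := [set \l s | s in 'N(P)].
Definition Aut_S0 P : {set hom P P} := [set chom P P s | s in NX P].
Definition Sigma_S0 P : {set sym X} := [set \l s | s in 'C(P)].

Definition extender P Q (f : mor P Q) : {set S} :=
  [set n in 'N(P) |
    (hcomp f.1 (hcomp (chom P P n) (hinv f.1)), f.2 * \l n * f.2^-1)
      \in Aut_SX Q].

Section System.
Variable XX : fusion_action_system.

Definition fusion P Q : {set hom P Q} := [set f.1 | f in XX P Q].

Definition conjugate P Q : Prop := isomorphic_in fusion P Q.

Definition Sigma P : {set sym X} := [set f.2 | f in XX P P].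
Definition fusion0 P : {set hom P P} := [set f : hom P P | (f, 1) \in XX P P].
Definition Sigma0 P : {set sym X} := [set s : sym X | (hid P, s) \in XX P P].

Definition fully_normalized P : Prop :=
  forall Q, conjugate P Q -> #|'N(Q)| <= #|'N(P)|.
Definition fully_centralized P : Prop :=
  forall Q, conjugate P Q -> #|'C(Q)| <= #|'C(P)|.
Definition fully_X_normalized P : Prop :=
  forall Q, conjugate P Q -> #|NX Q| <= #|NX P|.
Definition fully_X_centralized P : Prop :=
  forall Q, conjugate P Q -> #|ZX Q| <= #|ZX P|.

Fact Sigma_group_set P : group_set (Sigma P).
Proof.
apply/group_setP; split.
  by apply/imsetP; exists (mid P); first exact: fas_id.
move=> _ _ /imsetP[f Xf ->] /imsetP[g Xg ->].
by apply/imsetP; exists (mcomp f g); first exact: fas_comp.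
Qed.

Canonical Sigma_group P := Group (Sigma_group_set P).

(* The trivial group having a single automorphism, [Sigma 1] is the group XX(1)
   of automorphisms of the object 1, seen in sym X. *)
Lemma ell_Sigma1 s : \l s \in Sigma 1.
Proof.
apply/imsetP; exists (chom 1%G 1%G s, \l s); last by [].
apply: (subsetP (fas_trans XX _ _)); apply/imsetP; exists s; last by [].
by rewrite inE conjs1g subxx.
Qed.

Lemma iso_bij P Q (f : mor P Q) : f \in iso XX P Q ->
  hcomp (hinv f.1) f.1 = hid P /\ hcomp f.1 (hinv f.1) = hid Q.
Proof.
rewrite inE => /andP[_ /existsP[g /and3P[_ /eqP[gf _] /eqP[fg _]]]].
have gfK x : g.1 (f.1 x) = x by move/ffunP/(_ x): gf; rewrite !ffunE.
have fgK y : f.1 (g.1 y) = y by move/ffunP/(_ y): fg; rewrite !ffunE.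
split; apply/ffunP=> x; rewrite !ffunE; case: pickP => [y /eqP //|] /=.
- exact: (can_inj gfK).
- by move/(_ x); rewrite eqxx.
by move/(_ (g.1 x)); rewrite fgK eqxx.
Qed.

Lemma chomM P s t : t \in 'N(P) ->
  hcomp (chom P P s) (chom P P t) = chom P P (s * t).
Proof.
move=> tN; apply/ffunP=> x; rewrite !ffunE; congr (subg P _).
have Ptx : t * sgval x * t^-1 \in P.
  by have := memJ_norm (sgval x) (groupVr tN); rewrite subgP conjgE invgK mulgA.
by rewrite subgK // invMg !mulgA.
Qed.

Lemma extender_group_set P Q (f : mor P Q) :
  f \in iso XX P Q -> group_set (extender f).
Proof.
case/iso_bij=> ifK fiK.
have hcA T U V W (h1 : hom V W) (h2 : hom U V) (h3 : hom T U) :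
    hcomp h1 (hcomp h2 h3) = hcomp (hcomp h1 h2) h3.
  by apply/ffunP=> x; rewrite !ffunE.
have hc1 U V (h : hom U V) : hcomp (hid V) h = h.
  by apply/ffunP=> x; rewrite !ffunE.
have h1c U V (h : hom U V) : hcomp h (hid U) = h.
  by apply/ffunP=> x; rewrite !ffunE.
have chom1 U : chom U U 1 = hid U.
  by apply/ffunP=> x; rewrite !ffunE mul1g invg1 mulg1 sgvalK.
apply/group_setP; split.
  rewrite inE group1 /=; apply/imsetP; exists 1; first exact: group1.
  by rewrite !chom1 hc1 fiK morph1 mulg1 mulgV.
move=> n m /setIdP[nN /imsetP[s sN [es ess]]] /setIdP[mN /imsetP[t tN [et ett]]].
apply/setIdP; split; first exact: groupM.
apply/imsetP; exists (s * t); first exact: groupM.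
congr (_, _); last by rewrite !ellM ?in_setT // -ess -ett !mulgA mulgKV.
rewrite -chomM // -chomM // -es -et !hcA; congr hcomp; congr hcomp.
by rewrite -[RHS]hcA ifK h1c.
Qed.

Definition extender_group P Q (f : mor P Q) (isof : f \in iso XX P Q) :
  {group S} := Group (extender_group_set isof).

(* In the last clause P is contained in the extender, so that the condition on
   psi says that its restriction to P is f.1. *)
Record saturated (p : nat) : Prop := Saturated {
  sat_norm_Xnorm : forall P, fully_normalized P -> fully_X_normalized P;
  sat_norm_cent : forall P, fully_normalized P -> fully_centralized P;
  sat_Xnorm_Xcent : forall P, fully_X_normalized P -> fully_X_centralized P;
  sat_cent_Xcent : forall P, fully_centralized P -> fully_X_centralized P;
  sat_Syl_fusion : forall P, fully_normalized P ->
    p.-Sylow(perms (fusion P P)) (perms (Aut_S P));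
  sat_Syl_system : forall P, fully_normalized P ->
    p.-Sylow(pairs (XX P P)) (pairs (Aut_SX P));
  sat_Syl_Sigma : forall P, fully_normalized P ->
    p.-Sylow(Sigma P) (Sigma_S P);
  sat_Syl_fusion0 : forall P, fully_X_normalized P ->
    p.-Sylow(perms (fusion0 P)) (perms (Aut_S0 P));
  sat_Syl_Sigma0 : forall P, fully_centralized P ->
    p.-Sylow(Sigma0 P) (Sigma_S0 P);
  sat_extend : forall P Q (f : mor P Q) (isof : f \in iso XX P Q),
    fully_X_centralized Q ->
    exists2 psi : hom (extender_group isof) [set: S]%G,
      (psi, f.2) \in XX (extender_group isof) [set: S]%G &
      forall (x : [subg P]) (y : [subg extender_group isof]),
        sgval y = sgval x -> sgval (psi y) = sgval (f.1 x)
}.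

End System.
End Pairs.

(* F_S(G), when the group S is identified with its image under an injective
   homomorphism iota into the group G: the morphisms P -> Q are the c_g|_P with
   g in G, read through iota.  That f takes its values in Q expresses
   g (iota P) g^-1 <= iota Q. *)
Definition group_fusion (S gT : finGroupType) (iota : {morphism [set: S] >-> gT})
    (G : {group gT}) (P Q : {group S}) : {set hom P Q} :=
  [set f : hom P Q | [exists g in G,
    [forall x, iota (sgval (f x)) == g * iota (sgval x) * g^-1]]].

(* Main.v *)
Require Import Defs.
From HB Require Import structures.
From mathcomp Require Import all_boot all_fingroup all_solvable.

(** Faithfulness makes a morphism (phi, sigma) of the system XX determined by
    sigma: intertwining says that phi is conjugation by sigma, once S is seen
    inside the permutations of X.  So the two fusion systems agree as soon as
    the permutations occurring in XX are exactly the elements of G = XX(1), each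
    one occurring on every subgroup that it conjugates into S.

    A permutation occurring on some P -> Q also occurs at the trivial subgroup,
    by restriction ([fas_sub] with source and target 1).

    Conversely, let g be in G and conjugate P into Q.  The pair (id, g) is an
    isomorphism 1 -> 1 of XX, and 1 is fully X-centralized because it is
    conjugate only to itself.  The extender of (id, g) consists of the elements
    of S that g conjugates back into S ([conj_sub_extender]); it contains P.  The
    extension axiom of saturation thus provides a morphism (psi, g) defined
    on a subgroup containing P, and psi agrees on P with conjugation by g, again
    by faithfulness.  Shrinking its source to P and its target to Q
    ([fas_sub]) gives the required morphism of XX. *)

Set Implicit Arguments.
Unset Strict Implicit.
Unset Printing Implicit Defensive.

Local Open Scope group_scope.

Section Hom1.
Variable S : finGroupType.
Implicit Types P Q : {group S}.

Lemma subg1_eq1 (x : [subg [1 S]]) : x = 1.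
Proof. by apply: val_inj; apply/set1P/(subgP x). Qed.

Lemma hom_to1_eq P (f g : hom P [1 S]%G) : f = g.
Proof.
by apply/ffunP=> x; rewrite [f x]subg1_eq1 [g x]subg1_eq1.
Qed.

End Hom1.

Section FusionActionSystem.
Variables (S : finGroupType) (X : finType) (a : left_action S X).
Variable XX : fusion_action_system a.
Implicit Types P Q R : {group S}.

Lemma faithful_ell_inj : faithful_action a -> injective (ell a).
Proof.
move=> fa s t est; apply/eqP; rewrite eq_mulgV1; apply/eqP/fa=> x.
by rewrite lactM -ellE est ellE -lactM mulgV lact1.
Qed.

Lemma fas_intertwinedE P Q (f : mor X P Q) (x : [subg P]) : f \in XX P Q ->
  ell a (sgval (f.1 x)) = f.2 * ell a (sgval x) * f.2^-1.
Proof.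
by move/(subsetP (fas_intertwined XX P Q)); rewrite inE
  => /andP[_ /forallP/(_ x)/eqP].
Qed.

Lemma fas_incl P Q : P \subset Q -> mincl X P Q \in XX P Q.
Proof.
move=> sPQ; apply: (subsetP (fas_trans XX P Q)); apply/imsetP.
exists 1; first by rewrite inE invg1 conjsg1.
congr (_, _); last by rewrite [RHS](morph1 (ell_morphism a)).
by apply/ffunP=> x; rewrite !ffunE mul1g invg1 mulg1.
Qed.

(** Morphisms can be restricted in the source because the inclusions come from
    S (take s = 1), and in the target because of the factorization axiom: the
    isomorphism R1 through which the restricted morphism factors is onto, so
    R1 is the image and lies in any subgroup containing the values. *)
Lemma fas_sub P Q P' Q' (f : mor X P Q) (h : hom P' Q') :
    f \in XX P Q -> P' \subset P ->
    (forall (x : [subg P']) (y : [subg P]), sgval y = sgval x ->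
       sgval (h x) = sgval (f.1 y)) ->
  (h, f.2) \in XX P' Q'.
Proof.
move=> Xf sP'P hf.
have [R1 [g iso_g [sR1Q def_f]]] :=
  fas_factor (fas_comp Xf (fas_incl sP'P)).
have hg x : sgval (h x) = sgval (g.1 x).
  have /= := congr1 (fun k : mor X P' Q => sgval (k.1 x)) def_f.
  rewrite !ffunE subgK ?(subsetP sR1Q) ?subgP // => <-.
  by apply: hf; rewrite subgK // (subsetP sP'P) ?subgP.
have sR1Q' : R1 \subset Q'.
  apply/subsetP=> r R1r; have [_ /ffunP/(_ (subg R1 r))] := iso_bij iso_g.
  by rewrite !ffunE => /(congr1 sgval); rewrite -hg subgK // => <-; apply: subgP.
have -> : (h, f.2) = mcomp (mincl X R1 Q') g.
  congr (_, _).
    apply/ffunP=> x; apply: val_inj; rewrite /= hg !ffunE subgK //.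
    by rewrite (subsetP sR1Q') ?subgP.
  by have /= := congr1 snd def_f; rewrite mulg1.
apply: fas_comp (fas_incl sR1Q') _.
by case/setIdP: iso_g.
Qed.

Lemma mem_Sigma1 (g : sym X) :
  (g \in Sigma XX 1) = ((hid [1 S]%G, g) \in XX 1%G 1%G).
Proof.
apply/imsetP/idP => [[[h s] Xhs ->] | Xg]; last by exists (hid 1%G, g).
by rewrite (hom_to1_eq (hid _) h).
Qed.

Lemma Sigma1_iso (g : sym X) : g \in Sigma XX 1 ->
  (hid [1 S]%G, g) \in iso XX 1%G 1%G.
Proof.
move=> Gg; apply/setIdP; split; first by rewrite -mem_Sigma1.
have GVg : g^-1 \in Sigma_group XX 1 by rewrite groupV.
apply/existsP; exists (hid [1 S]%G, g^-1); rewrite -mem_Sigma1 GVg /=.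
by apply/andP; split; apply/eqP; congr (_, _);
  rewrite ?mulVg ?mulgV //; apply: hom_to1_eq.
Qed.

Lemma fas_mor_Sigma1 P Q (f : mor X P Q) : f \in XX P Q -> f.2 \in Sigma XX 1.
Proof.
move=> Xf; rewrite mem_Sigma1; apply: (fas_sub Xf (sub1G P)) => x y.
rewrite [x]subg1_eq1 [hid _ _]subg1_eq1 => y1.
(* The condition bears on the value at 1 only, and homomorphisms fix 1. *)
have := subsetP (fas_intertwined XX P Q) _ Xf; rewrite inE => /andP[].
rewrite inE => /andP[_ /forallP/(_ 1)/forallP/(_ 1)/eqP f11] _.
have -> : y = 1 by apply: val_inj.
by move: f11; rewrite mulg1 -{1}[f.1 1]mulg1 => /mulgI <-.
Qed.

Lemma fully_X_centralized1 : fully_X_centralized XX 1%G.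
Proof.
move=> Q [f [g [_ _ _ fg]]]; suff -> : Q = 1%G by [].
apply/eqP; rewrite -val_eqE /= -subG1; apply/subsetP=> q Qq; apply/set1P.
(* Q has at most one element, since [g] embeds it into the trivial group. *)
have fgK y : f (g y) = y by move/ffunP/(_ y): fg; rewrite !ffunE.
suff /(congr1 sgval) : subg Q q = 1 by rewrite subgK.
rewrite -[LHS]fgK -[RHS]fgK; congr (f _).
by rewrite [LHS]subg1_eq1 [RHS]subg1_eq1.
Qed.

(** Every automorphism of the trivial group is the identity, so only the
    permutation constrains membership in the extender. *)
Lemma conj_sub_extender (g : sym X) (n s : S) :
  g * ell a n * g^-1 = ell a s -> n \in extender a (hid [1 S]%G, g).
Proof.
have N1 t : t \in 'N([1 S]) by rewrite norm1 inE.
move=> gns; apply/setIdP; split; first exact: N1.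
apply/imsetP; exists s; first exact: N1.
by congr (_, _) => //; apply: hom_to1_eq.
Qed.

End FusionActionSystem.

Theorem proposition2p3p1 (p : nat) (S : finGroupType) (X : finType)
    (a : left_action S X) (XX : fusion_action_system a) :
  prime p -> (p.-group [set: S])%g -> saturated XX p -> faithful_action a ->
  forall P Q : {group S},
    fusion XX P Q =
    group_fusion (ell_morphism a) (Sigma_group XX 1%G) P Q.
Proof.
move=> _ _ satXX fa P Q; apply/setP=> h; rewrite [RHS]inE.
apply/imsetP/exists_inP => [[f Xf ->] | [g Gg /forallP def_h]].
  exists f.2; first exact: fas_mor_Sigma1 Xf.
  by apply/forallP=> x; apply/eqP; exact: fas_intertwinedE Xf.
have [psi Xpsi _] :=
  sat_extend satXX (Sigma1_iso Gg) (fully_X_centralized1 (XX := XX)).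
exists (h, g) => //; apply: (fas_sub Xpsi).
  apply/subsetP=> n Pn.
  apply: (conj_sub_extender (s := sgval (h (subg P n)))).
  by have /eqP/= -> := def_h (subg P n); rewrite subgK.
move=> x y eyx; apply: (faithful_ell_inj fa).
by have /eqP/= -> := def_h x; rewrite (fas_intertwinedE y Xpsi) eyx.
Qed.
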